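(* As $n\to\infty$, we have $$\sigma(K_n)=\left\lceil\log\log n+\tfrac{1}{2}\log\log\log n+\tfrac{1}{2}(\log \pi+1)+o(1)\right\rceil,$$ where all logarithms are base $2$. That is, there is a function $\varepsilon$ from the positive integers to $\mathbb{R}$ with $\varepsilon(n)\to 0$ as $n\to\infty$ such that for all sufficiently large $n$, $$\sigma(K_n)=\left\lceil\log_2\log_2 n+\tfrac{1}{2}\log_2\log_2\log_2 n+\tfrac{1}{2}(\log_2 \pi+1)+\varepsilon(n)\right\rceil.$$ Here $\sigma(K_n)$ is the orientation covering number of the complete graph $K_n$ on $n$ vertices.
   Context: An orientation of a graph $G$ assigns to every edge $xy\in E(G)$ exactly one of the two directions $(x,y)$ (oriented from $x$ to $y$, i.e. away from $x$) or $(y,x)$. Given a non-empty graph $G$ and $k$ orientations $\vec{G}_1,\dots,\vec{G}_k$ of $G$, we say that $\vec{G}_1,\dots,\vec{G}_k$ is an orientation covering of $G$ if whenever $x,y,z\in V(G)$ with $xy,xz\in E(G)$ ($y=z$ is allowed), there is some $i$ such that $(x,y),(x,z)\in E(\vec{G}_i)$, i.e. both edges are oriented away from $x$ in $\vec{G}_i$. The orientation covering number $\sigma(G)$ is the smallest positive integer $k$ such that there is a list of $k$ orientations of $G$ forming an orientation covering of $G$. *)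

(* Defs.v *)
From HB Require Import structures.
From mathcomp Require Import all_boot all_order all_algebra.
From mathcomp Require Import all_classical all_reals all_analysis.

Set Implicit Arguments.
Unset Strict Implicit.
Unset Printing Implicit Defensive.

Import Order.TTheory GRing.Theory Num.Theory.
Import numFieldNormedType.Exports.

Record sgraph : Type := SGraph {
  vertex :> finType;
  adj : rel vertex;
  adj_sym : symmetric adj;
  adj_irrefl : irreflexive adj
}.

(* An orientation is given by its arc set: (x, y) \in A means that the edge
   xy is directed from x to y. *)
Definition is_orientation (G : sgraph) (A : {set G * G}) : bool :=
  [forall x : G, forall y : G,
     if adj x y then ((x, y) \in A) (+) ((y, x) \in A) else (x, y) \notin A].

Definition orientation_covering (G : sgraph) (D : seq {set G * G}) : bool :=
  all (@is_orientation G) D &&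
  [forall x : G, forall y : G, forall z : G,
     adj x y && adj x z ==>
     has (fun A : {set G * G} => ((x, y) \in A) && ((x, z) \in A)) D].

Definition has_orientation_covering (G : sgraph) (k : nat) : bool :=
  [exists D : k.-tuple {set G * G}, orientation_covering D].

(* Orient the edges along a fixed enumeration of the vertices, except that, if
   o = Some x, all edges at x point away from x. *)
Definition star_orientation (G : sgraph) (o : option G) : {set G * G} :=
  [set p | adj p.1 p.2 &&
     ((o == Some p.1) ||
      ((o != Some p.2) && (enum_rank p.1 < enum_rank p.2)%N))].

Lemma star_orientationP (G : sgraph) (o : option G) :
  is_orientation (star_orientation o).
Proof.
apply/forallP => x; apply/forallP => y; rewrite !inE /=.
case: (boolP (adj x y)) => [xy|//]; rewrite (adj_sym y x) xy /=.
have xNy : x != y by apply/eqP => xy'; rewrite xy' adj_irrefl in xy.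
have rNxy : (enum_rank x != enum_rank y :> nat).
  by apply: contra_neq xNy => /val_inj /enum_rank_inj.
case: (eqVneq o (Some x)) => [->|ox] /=.
  by rewrite (inj_eq Some_inj) (negPf xNy).
case: (eqVneq o (Some y)) => [//|oy] /=.
by case: ltngtP rNxy.
Qed.

Lemma ex_orientation_covering (G : sgraph) :
  exists k : nat, (0 < k)%N && has_orientation_covering G k.
Proof.
exists #|{: option G}|; rewrite card_option /=.
apply/existsP; rewrite -card_option.
have sD : size (map (@star_orientation G) (enum {: option G}))
          == #|{: option G}| by rewrite size_map -cardE.
exists (Tuple sD); apply/andP; split => /=.
  by apply/allP => A /mapP[v _ ->]; exact: star_orientationP.
apply/forallP => x; apply/forallP => y; apply/forallP => z.
apply/implyP => /andP[xy xz]; apply/hasP.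
exists (star_orientation (Some x)); first by rewrite map_f // mem_enum.
by rewrite !inE /= xy xz !eqxx.
Qed.

Definition orientation_covering_number (G : sgraph) : nat :=
  ex_minn (ex_orientation_covering G).

Lemma complete_adj_sym (n : nat) : symmetric (fun i j : 'I_n => i != j).
Proof. by move=> i j; rewrite eq_sym. Qed.

Lemma complete_adj_irrefl (n : nat) : irreflexive (fun i j : 'I_n => i != j).
Proof. by move=> i; rewrite eqxx. Qed.

Definition complete_graph (n : nat) : sgraph :=
  SGraph (@complete_adj_sym n) (@complete_adj_irrefl n).

(* Since ln is 0 on nonpositive reals, so is log2. *)
Definition log2 (R : realType) (x : R) : R := (ln x / ln 2)%R.

(* Main.v *)
(** Record, for each edge xy, the set of orientations in which it points away
    from x. The sets attached to a vertex form an intersecting family, and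
    reversing an edge complements its set; so the up-closures of these families,
    restricted to the sets containing a fixed index, are pairwise distinct, and a
    covering of K_n by k orientations forces n to be at most the number of
    antichains in the Boolean lattice of rank N = k - 1. Conversely, for 2j < N,
    every set of j-subsets of an N-set extends to a maximal intersecting family
    on k points, so n <= 2^C(N, j) suffices.

    The number of antichains is 2^((1 + o(1)) C(N, N/2)) (Kleitman). Branching on
    a vertex of comparability degree at least d shows that a graph on M vertices
    in which every sparse set has at most m elements has at most 2^m b^M
    independent sets, where b^d + 1 <= b^(d+1). A weighted LYM inequality gives
    m <= C(N, N/2) / (1 - 2d/N) + 2, and d proportional to N with
    b = 1 + o(1/sqrt N) makes b^(2^N) negligible. Wallis' formula then turns
    C(N, N/2) into the stated closed form. *)
Require Import Defs.
From HB Require Import structures.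
From mathcomp Require Import all_boot all_order all_algebra.
From mathcomp Require Import ring lra zify.

Set Implicit Arguments.
Unset Strict Implicit.
Unset Printing Implicit Defensive.

Import Order.TTheory GRing.Theory Num.Theory.
Local Open Scope ring_scope.

(** * Counting independent sets *)

Definition independent (T : finType) (r : rel T) (I : {set T}) : bool :=
  [forall x in I, forall y in I, ~~ r x y].

Lemma independentP (T : finType) (r : rel T) (I : {set T}) :
  reflect {in I &, forall x y, ~~ r x y} (independent r I).
Proof.
apply: (iffP forall_inP) => [H x y xI yI|H x xI].
  by move/forall_inP: (H x xI); apply.
by apply/forall_inP => y yI; apply: H.
Qed.

Lemma sub_independent (T : finType) (r : rel T) (I J : {set T}) :
  I \subset J -> independent r J -> independent r I.
Proof.
move=> /subsetP sIJ /independentP HJ; apply/independentP => x y xI yI.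
by apply: HJ; apply: sIJ.
Qed.

Section CountIndependent.
Variables (R : realDomainType) (T : finType) (r : rel T) (d m : nat) (b : R).
Hypothesis r_irr : irreflexive r.
Hypothesis sparse_le : forall V : {set T},
  (forall v, v \in V -> (#|[set w in V | r v w]| < d)%N) -> (#|V| <= m)%N.
Hypothesis b_ge1 : 1 <= b.
Hypothesis b_root : b ^+ d + 1 <= b ^+ d.+1.

(* For a vertex v of degree at least d in V, an independent set either avoids v
   or avoids all neighbours of v. *)
Lemma card_independent_le (V : {set T}) :
  #|[set I : {set T} | (I \subset V) && independent r I]|%:R
    <= 2 ^+ m * b ^+ #|V|.
Proof.
have b_ge0 : 0 <= b by apply: le_trans b_ge1.
have [k] := ubnP #|V|; elim: k V => // k IH V; rewrite ltnS => Vk.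
have [v /andP[vV dv]|noV] := pickP [pred v in V | d <= #|[set w in V | r v w]|]%N;
  last first.
  have mV : (#|V| <= m)%N.
    by apply: sparse_le => v vV; move: (noV v); rewrite /= vV /= ltnNge => ->.
  apply: (@le_trans _ _ (2 ^+ #|V|)).
    rewrite -natrX ler_nat -card_powerset subset_leq_card //.
    by apply/subsetP => I; rewrite !inE => /andP[].
  rewrite -[X in X <= _]mulr1 ler_pM ?exprn_ge0 ?ler01 //.
    by rewrite ler_weXn2l // ler1n.
  by rewrite exprn_ege1.
set X := [set I | _]; pose Nv := [set w in V | r v w].
set W := V :\ v; set U := W :\: Nv.
have sUW : U \subset W by rewrite subsetDl.
have cW : #|V| = #|W|.+1 by rewrite (cardsD1 v) vV.
have cU : (#|U| + d <= #|W|)%N.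
  have sNW : Nv \subset W.
    apply/subsetP => w; rewrite !inE => /andP[-> rvw]; rewrite andbT.
    by apply: contraTneq rvw => ->; rewrite r_irr.
  rewrite -(cardsID Nv W) (setIidPr sNW) addnC leq_add //.
have le1 : (#|X :&: [set I : {set T} | v \notin I]| <=
            #|[set I : {set T} | (I \subset W) && independent r I]|)%N.
  apply/subset_leq_card/subsetP => I; rewrite !inE => /andP[/andP[sIV iI] vI].
  by rewrite iI subsetD1 sIV vI.
have le2 : (#|X :\: [set I : {set T} | v \notin I]| <=
            #|[set I : {set T} | (I \subset U) && independent r I]|)%N.
  have inj : {in X :\: [set I : {set T} | v \notin I] &, injective (fun I => I :\ v)}.
    move=> I J; rewrite !inE !negbK => /andP[vI _] /andP[vJ _] e.
    by rewrite -(setD1K vI) e setD1K.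
  rewrite -(card_in_imset inj); apply/subset_leq_card/subsetP => K.
  move=> /imsetP[I]; rewrite !inE negbK => /and3P[vI sIV iI] ->.
  rewrite (sub_independent (subsetDl _ _) iI) andbT.
  apply/subsetP => w; rewrite !inE => /andP[-> wI]; rewrite (subsetP sIV) //=.
  by rewrite andbT; move/independentP: iI; apply.
rewrite -(cardsID [set I : {set T} | v \notin I] X) natrD.
have IHW := IH W; have IHU := IH U.
apply: (@le_trans _ _ (2 ^+ m * b ^+ #|W| + 2 ^+ m * b ^+ #|U|)).
  apply: lerD.
    by apply: le_trans (IHW _); [rewrite ler_nat | rewrite -cW].
  apply: le_trans (IHU _); first by rewrite ler_nat.
  by rewrite (leq_trans _ Vk) // cW ltnS subset_leq_card.
rewrite -mulrDr ler_pM2l ?exprn_gt0 ?ltr0n // cW.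
have -> : #|W| = (#|W| - d + d)%N by rewrite subnK // (leq_trans _ cU) ?leq_addl.
rewrite -addnS !exprD.
(* Since [#|U| <= #|W| - d], the sum is at most [b ^+ (#|W| - d)] times the left side of
   [b_root]. *)
apply: (@le_trans _ _ (b ^+ (#|W| - d) * (b ^+ d + 1))).
  rewrite mulrDr mulr1 lerD2l ler_weXn2l //.
  by rewrite -(leq_add2r d) subnK // (leq_trans _ cU) ?leq_addl.
by rewrite ler_wpM2l ?exprn_ge0.
Qed.
End CountIndependent.

(** * A weighted LYM inequality *)

Section WeightedLYM.
Variables (R : realFieldType) (T : finType) (F : {set {set T}}).

Let w (v a : nat) : R := 'C(v, a)%:R^-1.

(** An [a]-subset of a set of size [v.+1] survives the deletion of [v.+1 - a] of its points, so
    averaging over the deleted point preserves the weight. *)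
Lemma invbin_shift (v a : nat) : (a <= v)%N ->
  (v.+1 - a)%:R * w v a = v.+1%:R * w v.+1 a.
Proof.
move=> av; rewrite /w.
have h := mul_bin_down v.+1 a; rewrite /= in h.
have c0 : ('C(v, a)%:R : R) != 0 by rewrite pnatr_eq0 -lt0n bin_gt0.
have c1 : ('C(v.+1, a)%:R : R) != 0 by rewrite pnatr_eq0 -lt0n bin_gt0 ltnW.
by apply/eqP; rewrite eqr_div // -!natrM h eqxx.
Qed.

(* Since 1 / ('C(n, b) 'C(b, a)) is the probability that a random maximal chain
   passes through given nested sets of sizes a and b, the left-hand side of
   sum_chain_excess is the expected number of members of F on the chain minus the
   expected number of pairs of them, which is at most 1. *)
Definition chain_excess (B : {set T}) : R :=
  1 - \sum_(A in F | A \proper B) w #|B| #|A|.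

Lemma chain_excess_le1 (B : {set T}) : chain_excess B <= 1.
Proof. by rewrite lerBlDr lerDl sumr_ge0 // => A _; rewrite invr_ge0. Qed.

Lemma sum_chain_excess (V : {set T}) :
  \sum_(B in F | B \subset V) chain_excess B * w #|V| #|B| <= 1.
Proof.
have [k] := ubnP #|V|; elim: k V => // k IH V; rewrite ltnS => Vk.
have [VF|VF] := boolP (V \in F).
  (* The term of [V] is 1 minus the weights of the members strictly inside [V], and these weights
     dominate the remaining terms. *)
  rewrite (bigD1 V) /=; last by rewrite VF subxx.
  rewrite {1}/w binn invr1 mulr1.
  rewrite -lerBrDl /chain_excess opprB addrC subrK.
  have E B : (B \in F) && (B \proper V) = (B \in F) && (B \subset V) && (B != V).
    by rewrite properEneq -andbA [_ && (B != V)]andbC.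
  rewrite (eq_bigl _ _ E); apply: ler_sum => B _.
  by rewrite -[leRHS]mul1r ler_wpM2r ?invr_ge0 ?chain_excess_le1.
case V0 : #|V| => [|v].
  have {}V0 := cards0_eq V0.
  rewrite big1 // => B /andP[BF]; rewrite V0 subset0 => /eqP B0.
  by rewrite V0 -B0 BF in VF.
(* As [V] is not in [F], each member inside [V] misses a point of [V]: average the induction
   hypothesis over all [V :\ x]. *)
have v0 : (0 : R) < v.+1%:R by rewrite ltr0n.
rewrite -(ler_pM2l v0) mulr1.
have -> : v.+1%:R = \sum_(x in V) 1 :> R by rewrite sumr_const V0.
apply: (@le_trans _ _ (\sum_(x in V) \sum_(B in F | B \subset V :\ x)
     chain_excess B * w #|V :\ x| #|B|)); last first.
  apply: ler_sum => x xV; apply: IH.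
  by rewrite (leq_trans _ Vk) // (cardsD1 x V) xV.
rewrite (exchange_big_dep (fun B => (B \in F) && (B \subset V))) /=; last first.
  by move=> x B xV /andP[-> /subset_trans]; apply; rewrite subsetDl.
rewrite sumr_const V0 mulr_sumr; apply: ler_sum => B /andP[BF BV].
rewrite (eq_bigr (fun=> chain_excess B * w v #|B|)); last first.
  by move=> x /and3P[xV _ _]; move: V0; rewrite (cardsD1 x) xV add1n => -[->].
rewrite (eq_bigl (mem (V :\: B))); last first.
  by move=> x; rewrite !inE BF subsetD1 BV /= andbC.
rewrite sumr_const cardsD (setIidPr BV) V0 -[leRHS]mulr_natl.
rewrite mulrCA [X in _ <= X]mulrCA invbin_shift //.
rewrite -ltnS -V0 proper_card // properEneq BV andbT.
by apply: contraNneq VF => <-.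
Qed.
End WeightedLYM.

Lemma bin_ge_self (n k : nat) : (0 < k < n)%N -> (n <= 'C(n, k))%N.
Proof.
elim: n k => // n IH [//|k] /=; rewrite ltnS => kn.
rewrite binS; case: k kn => [|k] kn; first by rewrite bin0 bin1 addn1.
have [->|nk] := eqVneq n k.+2; first by rewrite binn add1n binSn.
rewrite -addn1 leq_add //; first by apply: IH; rewrite /= ltn_neqAle eq_sym nk.
by rewrite bin_gt0 ltnW.
Qed.

(** Both sides count nested pairs of sets of sizes [a] and [b]; this lets the weight of a pair be
    read from its smaller set. *)
Lemma mul_bin_trinomial (n b a : nat) : (a <= b <= n)%N ->
  ('C(n, b) * 'C(b, a) = 'C(n, a) * 'C(n - a, b - a))%N.
Proof.
move=> /andP[ab bn]; have an := leq_trans ab bn.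
have h1 := bin_fact bn; have h2 := bin_fact ab; have h3 := bin_fact an.
have h4 : ('C(n - a, b - a) * ((b - a)`! * (n - b)`!) = (n - a)`!)%N.
  by rewrite -(@bin_fact (n - a) (b - a)) ?leq_sub2r // subnBA // subnK.
apply/eqP; rewrite -(eqn_pmul2r (fact_gt0 a)) -(eqn_pmul2r (fact_gt0 (b - a))).
rewrite -(eqn_pmul2r (fact_gt0 (n - b))); apply/eqP.
transitivity (n`!); first by rewrite -h1 -h2; ring.
by rewrite -h3 -h4; ring.
Qed.

Lemma bin_le_half (n k : nat) : ('C(n, k) <= 'C(n, n./2))%N.
Proof.
have low i j : (i <= j <= n./2)%N -> ('C(n, i) <= 'C(n, j))%N.
  elim: j => [|j IH] /andP[]; first by rewrite leqn0 => /eqP->.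
  rewrite leq_eqVlt => /predU1P[->//|ij] jn.
  apply: leq_trans (IH _) _; first by rewrite -ltnS ij ltnW.
  rewrite -(leq_pmul2l (ltn0Sn j)) mul_bin_left leq_mul2r; apply/orP; right; lia.
have [kn|kn] := leqP k n./2; first by apply: low; rewrite kn leqnn.
have [kn'|kn'] := leqP k n; last by rewrite bin_small.
by rewrite -bin_sub //; apply: low; rewrite leqnn andbT; lia.
Qed.

(** * Families with few comparable pairs *)

Definition comparable_sets (T : finType) : rel {set T} :=
  fun A B => (A \proper B) || (B \proper A).

Section SparseFamily.
Variables (R : realFieldType) (T : finType) (F : {set {set T}}) (d : nat).
Let n := #|T|.
Hypothesis F0 : set0 \notin F.
Hypothesis FT : setT \notin F.
Hypothesis sparse :
  forall A, A \in F -> (#|[set B in F | comparable_sets A B]| <= d)%N.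

Let w (A : {set T}) : R := 'C(n, #|A|)%:R^-1.

(* The larger set pays when it has size at least n/2, the smaller one otherwise;
   this fails for the empty and the full set. *)
Lemma pair_weight_le (A B : {set T}) : A \in F -> B \in F -> A \proper B ->
  n%:R * (w B * 'C(#|B|, #|A|)%:R^-1) <= 2 * (w A + w B).
Proof.
move=> AF BF AB; have cAB := proper_card AB.
have cA : (0 < #|A|)%N by rewrite card_gt0; apply: contraNneq F0 => <-.
have cB : (#|B| < n)%N.
  by rewrite /n -cardsT; apply/proper_card; rewrite properT; apply: contraNneq FT => <-.
have w_ge0 C : 0 <= w C by rewrite invr_ge0.
have key (c k : nat) (x : R) : 0 <= x -> (c <= k)%N -> (n <= 2 * c)%N ->
    n%:R * (x * k%:R^-1) <= 2 * x.
  move=> x0 ck nc; have n0 : (0 < n)%N by apply: leq_ltn_trans cB.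
  have k0 : (0 < k%:R :> R) by rewrite ltr0n; lia.
  rewrite mulrCA mulrC ler_wpM2r // ler_pdivrMr // -natrM ler_nat; lia.
rewrite mulrDr; have [nB|nB] := leqP n (2 * #|B|).
  apply: le_trans (_ : 2 * w B <= _); last by rewrite lerDr mulr_ge0.
  by apply: (key #|B|) => //; rewrite bin_ge_self // cA.
apply: le_trans (_ : 2 * w A <= _); last by rewrite lerDl mulr_ge0.
rewrite /w -invfM -natrM mul_bin_trinomial; last by rewrite (ltnW cAB) ltnW.
rewrite natrM invfM; apply: (key (n - #|A|)%N); [exact: w_ge0| |lia].
by apply: bin_ge_self; lia.
Qed.

(** In the weighted LYM inequality for [setT], [pair_weight_le] charges each nested pair to its two
    members. Each member is charged at most [d] times, so the pairs cost at most 2d/n times the sum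
    of the [w A], and every [w A] is at least the inverse of the middle binomial coefficient. *)
Lemma card_sparse_family :
  #|F|%:R * (n%:R - 2 * d%:R) <= n%:R * 'C(n, n./2)%:R :> R.
Proof.
have w_ge0 C : 0 <= w C by rewrite invr_ge0.
have bound : (n%:R - 2 * d%:R) * (\sum_(B in F) w B) <= n%:R.
  have := sum_chain_excess R F setT; rewrite (eq_bigl (mem F)); last first.
    by move=> B; rewrite subsetT andbT.
  rewrite cardsT -/n => lym.
  have {}lym : n%:R * (\sum_(B in F) chain_excess R F B * w B) <= n%:R.
    by rewrite -[leRHS]mulr1 ler_wpM2l.
  apply: le_trans lym; rewrite mulrBl [n%:R * (\sum_(B in F) w B)]mulr_sumr.
  have -> : n%:R * (\sum_(B in F) chain_excess R F B * w B) =
    \sum_(B in F) n%:R * w B -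
    \sum_(B in F) \sum_(A in F | A \proper B) n%:R * (w B * 'C(#|B|, #|A|)%:R^-1).
    rewrite -sumrB mulr_sumr; apply: eq_bigr => B _.
    rewrite /chain_excess mulrBl mul1r mulrBr; congr (_ - _).
    by rewrite [_ * w B]mulrC !mulr_sumr.
  apply: lerB => //.
  apply: (@le_trans _ _ (\sum_(B in F) \sum_(A in F | A \proper B) 2 * (w A + w B))).
    apply: ler_sum => B BF; apply: ler_sum => A /andP[AF AB].
    exact: pair_weight_le.
  under eq_bigr do rewrite -mulr_sumr big_split /=.
  rewrite -mulr_sumr big_split /= -mulrA ler_wpM2l //.
  rewrite (exchange_big_dep (mem F)) /=; last by move=> ? ? ? /andP[].
  rewrite -big_split /= mulr_sumr; apply: ler_sum => A AF.
  have count (P : pred {set T}) :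
      \sum_(B in F | P B) w A = #|[set B in F | P B]|%:R * w A.
    by rewrite mulr_natl -sumr_const; apply: eq_bigl => B; rewrite inE.
  under eq_bigl do rewrite AF /=.
  (* The members above [A] and those below it are disjoint, so [sparse] bounds both counts
     together. *)
  rewrite !count -mulrDl -natrD ler_wpM2r // ler_nat (leq_trans _ (sparse AF)) //.
  rewrite -cardsUI -[leqRHS]addn0 leq_add //.
    apply/subset_leq_card/subsetP => B; rewrite !inE.
    by case/orP => /andP[-> AB]; rewrite /comparable_sets AB ?orbT.
  rewrite leqn0 cards_eq0; apply/eqP/setP => B; rewrite !inE.
  apply/negP => /andP[/andP[_ AB] /andP[_ BA]].
  by move: (proper_trans AB BA); rewrite properxx.
have wB B : 'C(n, n./2)%:R^-1 <= w B.
  by rewrite lef_pV2 ?ler_nat ?bin_le_half // posrE ltr0n bin_gt0 ?max_card //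
     -divn2 leq_div.
have [dn|dn] := leP (n%:R - 2 * d%:R : R) 0.
  by apply: (@le_trans _ _ 0); rewrite ?mulr_ge0 // mulr_ge0_le0.
have C0 : (0 < 'C(n, n./2)%:R :> R) by rewrite ltr0n bin_gt0 -divn2 leq_div.
rewrite -ler_pdivrMr //; apply: le_trans bound.
rewrite mulrAC mulrC ler_pM2l // mulr_natl -sumr_const; exact: ler_sum.
Qed.
End SparseFamily.

(** * From coverings to antichains and back *)

Lemma card_set_type (T : finType) : #|{set T}| = (2 ^ #|T|)%N.
Proof. by have := card_powerset [set: T]; rewrite powersetT !cardsT. Qed.

Lemma comparable_sets_irr (T : finType) : irreflexive (@comparable_sets T).
Proof. by move=> A; rewrite /comparable_sets properxx. Qed.

Lemma card_antichains (R : realFieldType) (T : finType) (d m : nat) (b : R) :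
  #|T|%:R * 'C(#|T|, #|T|./2)%:R < m.+1%:R * (#|T|%:R - 2 * d%:R) :> R ->
  1 <= b -> b ^+ d + 1 <= b ^+ d.+1 ->
  #|[set I : {set {set T}} | independent (@comparable_sets T) I]|%:R
    <= 2 ^+ m.+2 * b ^+ (2 ^ #|T|).
Proof.
move=> dm b1 bd.
have -> : [set I : {set {set T}} | independent (@comparable_sets T) I] =
  [set I : {set {set T}} | (I \subset setT) && independent (@comparable_sets T) I].
  by apply/setP => I; rewrite !inE subsetT.
have -> : (2 ^ #|T|)%N = #|[set: {set T}]| by rewrite cardsT card_set_type.
apply: (@card_independent_le _ _ _ d) => // [|F sF]; first exact: comparable_sets_irr.
(* [card_sparse_family] excludes the empty and the full set; putting them back turns [m] into
   [m.+2]. *)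
have F'F : F :\ set0 :\ setT \subset F by rewrite (subset_trans (subsetDl _ _)) ?subsetDl.
have cF : (#|F| <= #|F :\ set0 :\ setT|.+2)%N.
  rewrite (cardsD1 set0) (cardsD1 setT (F :\ _)) addnA -add2n leq_add2r.
  exact: leq_add (leq_b1 _) (leq_b1 _).
apply: (leq_trans cF); rewrite 2!ltnS -ltnS -(@ltr_nat R).
have dn : 0 < #|T|%:R - 2 * d%:R :> R.
  by rewrite -(@pmulr_rgt0 _ m.+1%:R) ?ltr0n //; apply: le_lt_trans dm; rewrite mulr_ge0.
rewrite -(ltr_pM2r dn); apply: le_lt_trans dm; apply: card_sparse_family.
- by rewrite !inE eqxx !andbF.
- by rewrite !inE eqxx.
move=> A /(subsetP F'F) /sF /ltnW; apply: leq_trans; apply/subset_leq_card.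
by apply/subsetP => B; rewrite !inE => /andP[/and3P[_ _ ->] ->].
Qed.

(** * Distinct antichains from a covering *)

Section CoveringUpper.
Variables (n N : nat) (D : (N.+1).-tuple {set complete_graph n * complete_graph n}).
Hypothesis covD : orientation_covering D.
Implicit Types (x y z : 'I_n) (a : {set 'I_N}).

Let arcs x y : {set 'I_N.+1} := [set i | (x, y) \in tnth D i].

Lemma arcs_compl x y : x != y -> arcs y x = ~: arcs x y.
Proof.
move=> xy; apply/setP => i; rewrite !inE.
case/andP: covD => /allP /(_ _ (mem_tnth i D)) /forallP/(_ x)/forallP/(_ y) + _.
by rewrite /= xy; do 2!case: (_ \in _).
Qed.

Lemma arcs_meet x y z : x != y -> x != z -> arcs x y :&: arcs x z != set0.
Proof.
move=> xy xz; case/andP: covD => _ /forallP/(_ x)/forallP/(_ y)/forallP/(_ z).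
rewrite /= xy xz /= => /hasP[A /tnthP[i ->] /andP[iy iz]].
by apply/set0Pn; exists i; rewrite !inE iy iz.
Qed.

Let up x : {set {set 'I_N}} :=
  [set a : {set 'I_N} | [exists y : 'I_n,
     (x != y) && (arcs x y \subset ord0 |: (lift ord0 @: a))]].

(** One of [arcs x y] and [arcs y x] contains [ord0], say the former. Its trace lies in [up x]; if
    it lay in [up y], some [arcs y z] would be inside [arcs x y], hence disjoint from [arcs y x]. *)
Lemma up_inj : injective up.
Proof.
have half x y : x != y -> ord0 \in arcs x y -> up x <> up y.
  move=> xy o e; pose a := [set j | lift ord0 j \in arcs x y].
  have aE : ord0 |: (lift ord0 @: a) = arcs x y.
    apply/setP => i; have [j ->|->] := unliftP ord0 i.
      rewrite in_setU1 (mem_imset _ _ lift_inj) [j \in a]in_set eq_sym.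
      by rewrite (negPf (neq_lift _ _)).
    by rewrite setU11 o.
  have : a \in up x by rewrite inE; apply/existsP; exists y; rewrite xy aE subxx.
  rewrite e inE => /existsP[z /andP[yz]]; rewrite aE => sz.
  have yx : y != x by rewrite eq_sym.
  have := arcs_meet yx yz; rewrite (arcs_compl xy) setIC -setDE.
  by rewrite setD_eq0 sz.
move=> x y e; apply/eqP/negPn/negP => xy.
have [o|o] := boolP (ord0 \in arcs x y); first exact: (half x y).
apply: (half y x); rewrite ?(eq_sym y) //.
by rewrite (arcs_compl xy) in_setC.
Qed.

Let minup x : {set {set 'I_N}} := [set a : {set 'I_N} | minset (mem (up x)) a].

(** An up-set is determined by its minimal members, which form an antichain, so [minup] embeds the
    vertices into the antichains. *)
Lemma covering_antichains :
  (n <= #|[set I : {set {set 'I_N}} | independent (@comparable_sets _) I]|)%N.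
Proof.
have upP x a : (a \in up x) = [exists c in minup x, c \subset a].
  apply/idP/exists_inP => [/minset_exists[c mc ca]|[c]].
    by exists c => //; rewrite inE.
  rewrite inE => /minsetP[+ _] ca; rewrite !inE => /existsP[y /andP[xy sy]].
  apply/existsP; exists y; rewrite xy; apply: subset_trans sy _.
  by rewrite setUS // imsetS.
have inj : injective minup.
  by move=> x y e; apply: up_inj; apply/setP => a; rewrite !upP e.
rewrite -{1}(card_ord n) -cardsT -(card_imset _ inj).
apply/subset_leq_card/subsetP => I /imsetP[x _ ->]; rewrite inE.
apply/independentP => a c; rewrite !inE => /minsetP[ax amin] /minsetP[cx cmin].
rewrite negb_or; apply/andP; split; apply/negP; rewrite properEneq => /andP[/eqP ne s].
  exact/ne/cmin.
exact/ne/amin.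
Qed.
End CoveringUpper.

(** * Coverings from sets of small subsets *)

Section CoveringLower.
Variables (n N j : nat).
Hypothesis jN : (j.*2 < N)%N.
Hypothesis nj : (n <= 2 ^ 'C(N, j))%N.

Let layer : {set {set 'I_N}} := [set a : {set 'I_N} | #|a| == j].
Let fam (x : 'I_n) : {set {set 'I_N}} := nth set0 (enum (powerset layer)) x.

Lemma card_powerset_layer : #|powerset layer| = (2 ^ 'C(N, j))%N.
Proof. by rewrite card_powerset card_draws card_ord. Qed.

Lemma fam_layer x : fam x \subset layer.
Proof.
rewrite -powersetE -mem_enum; apply: mem_nth.
by rewrite -cardE card_powerset_layer (leq_trans _ nj).
Qed.

Lemma fam_inj : injective fam.
Proof.
move=> x y /eqP; rewrite nth_uniq ?enum_uniq -?cardE ?card_powerset_layer ?(leq_trans _ nj) //.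
by move/eqP/val_inj.
Qed.

(** Picking from the symmetric difference makes the choice independent of the order of [x] and [y];
    the default [set0] occurs only for [x = y]. *)
Let witness (x y : 'I_n) : {set 'I_N} :=
  odflt set0 [pick a in (fam x :\: fam y) :|: (fam y :\: fam x)].

Lemma witnessC x y : witness x y = witness y x.
Proof. by rewrite /witness setUC. Qed.

Lemma witnessP x y : x != y -> (witness x y \in fam x) = (witness x y \notin fam y).
Proof.
move=> xy; rewrite /witness; case: pickP => [a|no] /=.
  by rewrite !inE; do 2!case: (_ \in _).
case/eqP: xy; apply: fam_inj; apply/setP => a.
by move: (no a); rewrite !inE; do 2!case: (_ \in _).
Qed.

Lemma card_witness x y : x != y -> #|witness x y| = j.
Proof.
move=> xy; have := witnessP xy; case: (boolP (_ \in fam x)) => [|_ /esym/negPn].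
  by move/(subsetP (fam_layer x)); rewrite inE => /eqP.
by move/(subsetP (fam_layer y)); rewrite inE => /eqP.
Qed.

(* The maximal intersecting family of x has, among the sets containing ord0, those
   whose trace on 'I_N has more than j elements or lies in [fam x]; [arcs x y] is
   a member of it whose complement is a member of that of y. *)
Let arcs (x y : 'I_n) : {set 'I_N.+1} :=
  let B := ord0 |: (lift ord0 @: witness x y) in
  if witness x y \in fam x then B else ~: B.

Lemma family_arcs_compl x y : x != y -> arcs y x = ~: arcs x y.
Proof.
move=> xy; rewrite /arcs (witnessC y x) (witnessP xy).
by case: (_ \in _); rewrite ?setCK.
Qed.

Lemma mem_lift_arcs x y i :
  (lift ord0 i \in arcs x y) = ((i \in witness x y) == (witness x y \in fam x)).
Proof.
rewrite /arcs; case: (_ \in fam x); rewrite !inE (mem_imset _ _ lift_inj).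
  by rewrite eq_sym (negPf (neq_lift _ _)) eqb_id.
by rewrite eq_sym (negPf (neq_lift _ _)) eqbF_neg.
Qed.

Lemma mem0_arcs x y : (ord0 \in arcs x y) = (witness x y \in fam x).
Proof. by rewrite /arcs; case: (_ \in fam x); rewrite !inE eqxx. Qed.

(** If both witnesses are in [fam x], the arcs share [ord0]. If just one is, the witnesses are
    distinct sets of equal size, so that one has an element outside the other. If neither is, two
    [j]-sets cannot cover ['I_N] because [j.*2 < N]. *)
Lemma family_arcs_meet x y z : x != y -> x != z -> arcs x y :&: arcs x z != set0.
Proof.
move=> xy xz; apply/set0Pn.
have cy := card_witness xy; have cz := card_witness xz.
case hy : (witness x y \in fam x); case hz : (witness x z \in fam x).
- by exists ord0; rewrite inE !mem0_arcs hy hz.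
- have : witness x y :\: witness x z != set0.
    rewrite setD_eq0; apply/negP => s; have /eqP e : witness x y == witness x z.
      by rewrite eqEcard s cy cz leqnn.
    by rewrite e hz in hy.
  case/set0Pn => i; rewrite inE => /andP[iz iy]; exists (lift ord0 i).
  by rewrite inE !mem_lift_arcs hy hz iy (negPf iz).
- have : witness x z :\: witness x y != set0.
    rewrite setD_eq0; apply/negP => s; have /eqP e : witness x z == witness x y.
      by rewrite eqEcard s cy cz leqnn.
    by rewrite e hy in hz.
  case/set0Pn => i; rewrite inE => /andP[iy iz]; exists (lift ord0 i).
  by rewrite inE !mem_lift_arcs hy hz iz (negPf iy).
have : ~: (witness x y :|: witness x z) != set0.
  rewrite -card_gt0 cardsCs setCK card_ord subn_gt0.
  by rewrite (leq_ltn_trans (leq_card_setU _ _)) // cy cz addnn.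
case/set0Pn => i; rewrite !inE negb_or => /andP[iy iz]; exists (lift ord0 i).
by rewrite inE !mem_lift_arcs hy hz (negPf iy) (negPf iz).
Qed.

Lemma has_covering_of_le : has_orientation_covering (complete_graph n) N.+1.
Proof.
pose D := [tuple [set p : complete_graph n * complete_graph n |
   (p.1 != p.2) && (i \in arcs p.1 p.2)] | i < N.+1].
apply/existsP; exists D; apply/andP; split.
  apply/allP => A /tnthP[i ->]; rewrite tnth_mktuple.
  apply/forallP => x; apply/forallP => y; rewrite !inE /= eq_sym.
  case: (eqVneq y x) => //= yx; rewrite (family_arcs_compl yx) inE.
  by case: (_ \in _).
apply/forallP => x; apply/forallP => y; apply/forallP => z.
apply/implyP => /andP[/= xy xz]; have /set0Pn[i] := family_arcs_meet xy xz.
rewrite inE => /andP[iy iz]; apply/hasP; exists (tnth D i); first exact: mem_tnth.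
by rewrite tnth_mktuple !inE /= xy xz iy iz.
Qed.
End CoveringLower.

(** * Wallis' formula *)

(* Imported only here: classical_sets shadows the finite-set lemmas used above. *)
From mathcomp Require Import all_classical all_reals all_analysis.
Import numFieldNormedType.Exports.
Local Open Scope classical_set_scope.

Section Wallis.
Variable R : realType.
Implicit Types (x : R) (n m : nat).

(** The reduction formula obtained by integrating sin^n by parts. *)
Fixpoint sinX_prim n : R -> R :=
  match n with
  | 0 => id
  | 1 => - cos
  | m.+2 => m.+2%:R^-1 *: (m.+1%:R *: sinX_prim m - cos * sin ^+ m.+1)
  end.

Lemma is_derive_sinX_prim n x : is_derive x 1 (sinX_prim n) (sin x ^+ n).
Proof.
elim/ltn_ind: n => -[|[|n]] IH.
- by rewrite expr0; apply: is_derive_id.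
- by apply: is_derive_eq; rewrite opprK expr1.
have dn := IH n (ltnW (ltnSn _)).
apply: is_derive_eq.
have c2 := cos2sin2 x; rewrite expr2 in c2.
rewrite /GRing.scale /= !fctE /=.
have -> : cos x * (n.+1%:R * sin x ^+ n * cos x) =
    n.+1%:R * sin x ^+ n * (cos x * cos x) by ring.
rewrite c2 !exprS expr0 -![n.+2]addn2 -![n.+1]addn1 !natrD.
by field; rewrite -natrD pnatr_eq0 addn2.
Qed.

(* That is, the integral of sin^n over [0, pi/2]. *)
Definition wallis n : R := sinX_prim n (pi / 2) - sinX_prim n 0.

Lemma wallis0 : wallis 0 = pi / 2. Proof. by rewrite /wallis /= subr0. Qed.

Lemma wallis1 : wallis 1 = 1.
Proof. by rewrite /wallis /= !fctE cos_pihalf cos0 oppr0 add0r opprK. Qed.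

Lemma wallisSS n : wallis n.+2 = n.+1%:R / n.+2%:R * wallis n.
Proof.
rewrite /wallis /= !fctE cos_pihalf sin0 expr0n mul0r mulr0 !subr0.
by rewrite /GRing.scale /= -!mulrBr mulrA [_^-1 * _]mulrC.
Qed.

Lemma wallis_gt0 n : 0 < wallis n.
Proof.
elim/ltn_ind: n => -[|[|n]] IH; rewrite ?wallis0 ?wallis1 ?wallisSS ?divr_gt0 ?pi_gt0 //.
by rewrite mulr_gt0 ?divr_gt0 ?ltr0n //; apply: IH.
Qed.

(** On [0, pi/2] the sine lies in [0, 1], so the difference of the two antiderivatives is
    nondecreasing. *)
Lemma wallis_decr n : wallis n.+1 <= wallis n.
Proof.
pose G := sinX_prim n - sinX_prim n.+1.
have dG x : is_derive x 1 G (sin x ^+ n - sin x ^+ n.+1).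
  by apply: is_deriveB; apply: is_derive_sinX_prim.
have GG : G 0 <= G (pi / 2).
  apply: (@ger0_derive1_ndecr _ G 0 (pi / 2)) => //.
  - move=> x; rewrite in_itv /= => /andP[x0 xpi].
    rewrite derive1E (@derive_val _ _ _ _ _ _ _ (dG x)) exprSr -{1}[_ ^+ n]mulr1 -mulrBr.
    by rewrite mulr_ge0 ?subr_ge0 ?sin_le1 // exprn_ge0 // ltW // sin_gt0_pihalf // x0.
  - by apply: derivable_within_continuous => x _; case: (dG x).
  by rewrite divr_ge0 ?pi_ge0.
by move: GG; rewrite /G !fctE /wallis; lra.
Qed.

(** By [wallisSS] the product does not change from [n] to [n.+1]. *)
Lemma wallis_mul n : n.+1%:R * (wallis n * wallis n.+1) = pi / 2.
Proof.
elim: n => [|n IH]; first by rewrite wallis0 wallis1 mul1r mulr1.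
rewrite -IH wallisSS; field.
by apply: lt0r_neq0; have := ler0n R n; lra.
Qed.

Lemma wallis_even m : wallis m.*2 = pi / 2 * ('C(m.*2, m)%:R / 4 ^+ m).
Proof.
elim: m => [|m IH]; first by rewrite wallis0 bin0 expr0 divr1 mulr1.
rewrite doubleS wallisSS {}IH.
have h : (m.+1 * 'C(m.*2.+2, m.+1) = 2 * m.*2.+1 * 'C(m.*2, m))%N.
  have h1 := mul_bin_diag m.*2.+2 m; have h2 := mul_bin_down m.*2.+1 m.
  rewrite /= in h1 h2; rewrite -h1 -mulnA h2.
  by rewrite -doubleS -mul2n -mulnA; congr (_ * (_ * _))%N; lia.
have {}h : m.+1%:R * 'C(m.*2.+2, m.+1)%:R = 2 * m.*2.+1%:R * 'C(m.*2, m)%:R :> R.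
  by rewrite -!natrM h.
have m0 : m.+1%:R != 0 :> R by rewrite pnatr_eq0.
have -> : 'C(m.*2.+2, m.+1)%:R = 2 * m.*2.+1%:R * 'C(m.*2, m)%:R / m.+1%:R :> R.
  by rewrite -h mulrC mulKf.
rewrite exprS -doubleS -(mul2n m.+1) natrM; field.
by rewrite expf_neq0 // nat1r.
Qed.

Lemma central_bin_wallis m :
  ('C(m.*2, m)%:R / 4 ^+ m) ^+ 2 = 4 / pi ^+ 2 * wallis m.*2 ^+ 2 :> R.
Proof.
rewrite wallis_even; move: (pi) (lt0r_neq0 (pi_gt0 R)) => p p0.
by field; rewrite p0 expf_neq0.
Qed.

(** In [central_bin_wallis], one factor [wallis m.*2] is replaced by its smaller successor, and
    [wallis_mul] evaluates the product; [central_bin_le] uses the larger predecessor instead. *)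
Lemma central_bin_ge m :
  2 / (pi * m.*2.+1%:R) <= ('C(m.*2, m)%:R / 4 ^+ m) ^+ 2 :> R.
Proof.
have p0 := pi_gt0 R; have m0 : 0 < m.*2.+1%:R :> R by rewrite ltr0n.
have -> : 2 / (pi * m.*2.+1%:R) = 4 / pi ^+ 2 * (wallis m.*2 * wallis m.*2.+1).
  apply: (mulfI (lt0r_neq0 m0)).
  rewrite [RHS]mulrCA wallis_mul; move: (pi) p0 => p p0.
  by field; rewrite nat1r !lt0r_neq0.
have c0 : 0 <= 4 / pi ^+ 2 :> R by rewrite divr_ge0 ?exprn_ge0 ?pi_ge0.
rewrite central_bin_wallis ler_wpM2l //.
by rewrite expr2 ler_pM2l ?wallis_decr ?wallis_gt0.
Qed.

Lemma central_bin_le m :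
  (0 < m)%N -> ('C(m.*2, m)%:R / 4 ^+ m) ^+ 2 <= 1 / (pi * m%:R) :> R.
Proof.
case: m => // m _; have p0 := pi_gt0 R; have m0 : 0 < m.+1%:R :> R by rewrite ltr0n.
have -> : 1 / (pi * m.+1%:R) = 4 / pi ^+ 2 * (wallis m.*2.+1 * wallis m.*2.+2).
  apply: (mulfI (lt0r_neq0 m0)).
  have <- : m.*2.+2%:R / 2 = m.+1%:R :> R.
    by rewrite -doubleS -mul2n natrM mulrC mulKf.
  rewrite [RHS]mulrCA -[m.*2.+2%:R / 2 * (wallis _ * _)]mulrA.
  rewrite [2^-1 * (wallis _ * _)]mulrC [m.*2.+2%:R * (_ / 2)]mulrA wallis_mul.
  move: (pi) p0 => p p0; by field; rewrite -natrD pnatr_eq0 !lt0r_neq0.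
have c0 : 0 <= 4 / pi ^+ 2 :> R by rewrite divr_ge0 ?exprn_ge0 ?pi_ge0.
rewrite central_bin_wallis ler_wpM2l //.
by rewrite expr2 ler_pM2r ?wallis_decr ?wallis_gt0.
Qed.

(** For odd [n], the middle coefficient is half of the central one in the next row, so the even case
    suffices. *)
Lemma middle_binE n :
  'C(n, n./2)%:R / 2 ^+ n = 'C((uphalf n).*2, uphalf n)%:R / 4 ^+ uphalf n :> R.
Proof.
have -> : (4 = 2 ^+ 2 :> R) by rewrite -natrX.
rewrite -exprM mul2n uphalf_half; have := odd_double_half n.
case: (odd n) => /=; last by rewrite !add0n => ->.
rewrite !add1n; move: n./2 => m <-; rewrite doubleS.
have -> : ('C(m.*2.+2, m.+1) = 2 * 'C(m.*2.+1, m))%N.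
  rewrite binS mulSn mul1n; congr (_ + _)%N.
  by rewrite -[RHS]bin_sub; [congr 'C(_, _); lia|lia].
by rewrite natrM [in RHS]exprS -mulf_div divff ?pnatr_eq0 // mul1r.
Qed.

Lemma middle_bin_ge n :
  2 / (pi * n.+2%:R) <= ('C(n, n./2)%:R / 2 ^+ n) ^+ 2 :> R.
Proof.
rewrite middle_binE; apply: le_trans (central_bin_ge _).
have p0 := pi_gt0 R; rewrite ler_pM2l // lef_pV2 ?posrE ?mulr_gt0 ?ltr0n //.
by rewrite ler_pM2l // ler_nat; lia.
Qed.

Lemma middle_bin_le n : (0 < n)%N ->
  ('C(n, n./2)%:R / 2 ^+ n) ^+ 2 <= 2 / (pi * n%:R) :> R.
Proof.
move=> n0; have m0 : (0 < uphalf n)%N by lia.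
have p0 := pi_gt0 R; rewrite middle_binE; apply: le_trans (central_bin_le m0) _.
rewrite ler_pdivrMr ?mulr_gt0 ?ltr0n // mulrAC ler_pdivlMr ?mulr_gt0 ?ltr0n //.
rewrite mul1r mulrCA ler_pM2l // -natrM ler_nat; lia.
Qed.
End Wallis.

(** * Asymptotics *)

Section Log2.
Variable R : realType.
Implicit Types x y : R.

Lemma ln2_ge : 2^-1 <= ln 2 :> R.
Proof.
have h : -1 < - 2^-1 :> R by lra.
have := le_ln1Dx h; have -> : 1 + - 2^-1 = 2^-1 :> R by lra.
by rewrite lnV ?posrE //; lra.
Qed.

Lemma ln2_gt0 : 0 < ln 2 :> R.
Proof. by have := ln2_ge; lra. Qed.

Lemma log2M x y : 0 < x -> 0 < y -> log2 (x * y) = log2 x + log2 y.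
Proof. by move=> x0 y0; rewrite /log2 lnM ?posrE // mulrDl. Qed.

Lemma log2V x : 0 < x -> log2 x^-1 = - log2 x.
Proof. by move=> x0; rewrite /log2 lnV ?posrE // mulNr. Qed.

Lemma log2Xn x n : 0 < x -> log2 (x ^+ n) = n%:R * log2 x.
Proof. by move=> x0; rewrite /log2 lnXn // mulrA mulr_natl. Qed.

Lemma log2_2 : log2 2 = 1 :> R.
Proof. by rewrite /log2 divff // lt0r_neq0 // ln2_gt0. Qed.

Lemma log2_1 : log2 1 = 0 :> R.
Proof. by rewrite /log2 ln1 mul0r. Qed.

Lemma le_log2 x y : 0 < x -> x <= y -> log2 x <= log2 y.
Proof.
move=> x0 xy; rewrite /log2 ler_pM2r ?invr_gt0 ?ln2_gt0 // ler_ln ?posrE //.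
exact: lt_le_trans xy.
Qed.

Lemma log2_ge0 x : 1 <= x -> 0 <= log2 x.
Proof. by move=> x1; rewrite -log2_1 le_log2. Qed.

Lemma log2_npos x : x <= 0 -> log2 x = 0.
Proof. by move=> x0; rewrite /log2 ln0 // mul0r. Qed.

Lemma log2_1D_le x : 0 <= x -> log2 (1 + x) <= 2 * x.
Proof.
move=> x0; rewrite /log2 ler_pdivrMr ?ln2_gt0 //.
have h : -1 < x by lra.
apply: le_trans (le_ln1Dx h) _; have := ln2_ge; nra.
Qed.

Lemma log2_1B_ge x : 0 <= x <= 2^-1 -> - (4 * x) <= log2 (1 - x).
Proof.
move=> /andP[x0 x1]; have y0 : 0 < 1 - x by lra.
rewrite -[1 - x]invrK log2V ?invr_gt0 // lerN2.
have -> : (1 - x)^-1 = 1 + x / (1 - x) by field; rewrite lt0r_neq0.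
apply: le_trans (log2_1D_le _) _; first by rewrite divr_ge0 // ltW.
suff : x / (1 - x) <= 2 * x by lra.
rewrite ler_pdivrMr //; nra.
Qed.

Lemma log2_le_sqrt x : 0 < x -> log2 x <= 4 * Num.sqrt x.
Proof.
move=> x0; have q0 : 0 < Num.sqrt x by rewrite sqrtr_gt0.
rewrite -{1}(@sqr_sqrtr _ x (ltW x0)) log2Xn //.
suff : log2 (Num.sqrt x) <= 2 * Num.sqrt x by lra.
rewrite /log2 ler_pdivrMr ?ln2_gt0 //.
have := ln_sublinear q0; have := ler_wpM2l (ltW q0) ln2_ge; lra.
Qed.
End Log2.

Lemma bernoulli_ineq (R : realDomainType) (x : R) n : 0 <= x -> n%:R * x <= (1 + x) ^+ n.
Proof.
move=> x0; suff : 1 + n%:R * x <= (1 + x) ^+ n by lra.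
elim: n => [|n IH]; first by rewrite mul0r addr0.
rewrite exprS -natr1; have n0 : 0 <= n%:R :> R by [].
by have := mulr_ge0 n0 x0; nra.
Qed.

(** * Explicit bound on the order of a covered complete graph *)

Section CountingBound.
Variable R : realType.
Implicit Types s N n : nat.

(* With e = N / 2s, Bernoulli's inequality gives b^(2e) (b - 1) >= e^2 (b - 1)^3,
   of order sqrt N / (16 s^5). *)
Lemma branching_root s N : (4 <= s)%N -> (256 * s ^ 10 <= N)%N ->
  let b : R := 1 + (s%:R * Num.sqrt N%:R)^-1 in
  b ^+ (N %/ (2 * s)).*2 + 1 <= b ^+ (N %/ (2 * s)).*2.+1.
Proof.
move=> s4 sN /=; set q := Num.sqrt _; set e := (N %/ _)%N; set de := _^-1.
have s0 : 0 < s%:R :> R by rewrite ltr0n; lia.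
(* This is the purpose of [256 * s ^ 10 <= N]: it yields 16 s^2 (s q)^3 <= q^4 <= (4 s e)^2
   below. *)
have q_ge : 16 * s%:R ^+ 5 <= q :> R.
  rewrite -[leLHS]ger0_norm ?mulr_ge0 ?exprn_ge0 ?ler0n // -sqrtr_sqr ler_wsqrtr //.
  by rewrite exprMn -exprM -!natrX -natrM ler_nat.
have q0 : 0 < q by apply: lt_le_trans q_ge; rewrite mulr_gt0 ?exprn_gt0.
have d0 : 0 < de by rewrite invr_gt0 mulr_gt0.
have qq : q ^+ 2 = N%:R by rewrite sqr_sqrtr.
have e_ge : q ^+ 2 <= 4 * s%:R * e%:R.
  rewrite qq -!natrM ler_nat.
  have : (2 * s <= N)%N.
    by apply: leq_trans sN; rewrite leq_mul // -[s in (s <= _)%N]expn1 leq_pexp2l //; lia.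
  have := divn_eq N (2 * s); have := @ltn_pmod N (2 * s); rewrite -/e.
  have [->|] := posnP e; [lia|nia].
rewrite exprSr mulrDr mulr1 lerD2l -muln2 exprM.
have be : e%:R * de <= (1 + de) ^+ e by apply: bernoulli_ineq; exact: ltW.
apply: le_trans (_ : (e%:R * de) ^+ 2 * de <= _); last first.
  by rewrite ler_pM2r // lerXn2r ?nnegrE ?mulr_ge0 ?exprn_ge0 // ?addr_ge0 // ltW.
have -> : (e%:R * de) ^+ 2 * de = e%:R ^+ 2 / (s%:R ^+ 3 * q ^+ 3).
  by rewrite /de; field; rewrite !lt0r_neq0.
rewrite ler_pdivlMr ?mulr_gt0 ?exprn_gt0 // mul1r.
have h : (q ^+ 2) ^+ 2 <= (4 * s%:R * e%:R) ^+ 2.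
  by rewrite lerXn2r ?nnegrE ?mulr_ge0 ?exprn_ge0 // ltW.
have s2 : 0 < 16 * s%:R ^+ 2 :> R by rewrite mulr_gt0 ?exprn_gt0.
rewrite -(ler_pM2l s2); apply: (@le_trans _ _ (q ^+ 4)).
  have -> : 16 * s%:R ^+ 2 * (s%:R ^+ 3 * q ^+ 3) = (16 * s%:R ^+ 5) * q ^+ 3 by ring.
  by rewrite [q ^+ 4]exprS ler_pM2r ?exprn_gt0.
by move: h; congr (_ <= _); ring.
Qed.

(** A crude form of [middle_bin_ge], using pi < 4 and N + 2 <= 3N; it compares the exponent [2 ^ N]
    of [b] with the main term. *)
Lemma middle_bin_sqrt N : (0 < N)%N ->
  2 ^+ N <= 3 * 'C(N, N./2)%:R * Num.sqrt N%:R :> R.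
Proof.
move=> N0; have n0 : 1 <= N%:R :> R by rewrite ler1n.
have c0 : 0 <= 3 * 'C(N, N./2)%:R * Num.sqrt N%:R :> R.
  by rewrite !mulr_ge0 // sqrtr_ge0.
rewrite -(ler_sqr _ c0) ?nnegrE ?exprn_ge0 // !exprMn sqr_sqrtr //.
have := middle_bin_ge R N; rewrite exprMn exprVn ler_pdivlMr ?exprn_gt0 //.
set X := (_ ^+ N) ^+ 2; have X0 : 0 < X by rewrite !exprn_gt0.
move=> h.
have p4 : pi < 4 :> R by have := pihalf_lt2 R; lra.
have p0 := pi_gt0 R.
have {h} : 2 * X <= 'C(N, N./2)%:R ^+ 2 * (pi * N.+2%:R).
  by rewrite -ler_pdivrMr ?mulr_gt0 ?ltr0n // mulrAC.
set Y := _ ^+ 2; have Y0 : 0 <= Y by rewrite exprn_ge0.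
have : pi * N.+2%:R <= 12 * N%:R :> R.
  by rewrite -addn2 natrD; nra.
move=> h1 h2; have := ler_wpM2l Y0 h1; have : 0 <= Y * N%:R by rewrite mulr_ge0.
lra.
Qed.

(** The relative error 12/s is the sum of 4/s from the sparse families, 2/s from the two extra sets,
    as [s <= N <= C], and 6/s from the factor [b ^+ (2 ^ N)]. *)
Lemma covering_log2_le s N n : (4 <= s)%N -> (256 * s ^ 10 <= N)%N -> (0 < n)%N ->
  has_orientation_covering (complete_graph n) N.+1 ->
  log2 n%:R <= 'C(N, N./2)%:R * (1 + 12 / s%:R) :> R.
Proof.
move=> s4 sN n0 /existsP[D covD].
have s0 : 4 <= s%:R :> R by rewrite ler_nat.
have sleN : (s <= N)%N.
  apply: leq_trans sN; rewrite -[s in (s <= _)%N]mul1n leq_mul //.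
  by rewrite -[s in (s <= _)%N]expn1 leq_pexp2l //; lia.
have N0 : 0 < N%:R :> R by rewrite ltr0n; lia.
set C := 'C(N, N./2); have CN : (N <= C)%N by apply: bin_ge_self; lia.
have C0 : 0 < C%:R :> R by rewrite ltr0n; lia.
pose d := (N %/ (2 * s)).*2; pose b : R := 1 + (s%:R * Num.sqrt N%:R)^-1.
have b1 : 1 <= b by rewrite lerDl invr_ge0 mulr_ge0 // sqrtr_ge0.
have dN : N%:R * (1 - 2 / s%:R) <= N%:R - 2 * d%:R :> R.
  rewrite mulrBr mulr1 lerB // mulrA [N%:R * 2]mulrC -mulrA.
  rewrite ler_pM2l // ler_pdivlMr -?natrM ?ler_nat; last lra.
  by rewrite /d -muln2 -mulnA [(2 * s)%N]mulnC; apply: leq_trunc_div.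
have s20 : 0 < 1 - 2 / s%:R :> R.
  by rewrite subr_gt0 ltr_pdivrMr; lra.
have dN0 : 0 < N%:R - 2 * d%:R :> R by apply: lt_le_trans dN; rewrite mulr_gt0.
(* The bound of [card_sparse_family]; its integer part [m] satisfies [x < m.+1], as
   [card_antichains] requires. *)
pose x : R := N%:R * C%:R / (N%:R - 2 * d%:R).
have x0 : 0 <= x by rewrite divr_ge0 ?mulr_ge0 // ltW.
have /andP[mx xm] := truncn_itv x0; set m := Num.truncn x in mx xm.
have := @card_antichains R 'I_N d m b; rewrite !card_ord => bound.
have {}bound : n%:R <= 2 ^+ m.+2 * b ^+ (2 ^ N) :> R.
  apply: le_trans (bound _ _ _) => //.
  - by rewrite ler_nat; exact: covering_antichains covD.
  - by rewrite -ltr_pdivrMr.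
  exact: branching_root.
apply: le_trans (le_log2 _ bound) _; first by rewrite ltr0n.
have b0 : 0 < b by apply: lt_le_trans b1.
rewrite log2M ?exprn_gt0 // !log2Xn // log2_2 mulr1.
have lb : log2 b <= 2 * (s%:R * Num.sqrt N%:R)^-1.
  by apply: log2_1D_le; rewrite invr_ge0 mulr_ge0 // sqrtr_ge0.
have h1 : x <= C%:R * (1 + 4 / s%:R).
  rewrite ler_pdivrMr //.
  apply: le_trans (_ : C%:R * (1 + 4 / s%:R) * (N%:R * (1 - 2 / s%:R)) <= _).
    rewrite mulrCA -mulrA mulrCA [leLHS]mulrC ler_pM2l //.
    rewrite -[leLHS]mulr1 ler_pM2l //.
    have -> : (1 + 4 / s%:R) * (1 - 2 / s%:R) = 1 + 2 / s%:R * (1 - 4 / s%:R) :> R.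
      by field; lra.
    by rewrite lerDl mulr_ge0 ?divr_ge0 // subr_ge0 ler_pdivrMr; lra.
  by rewrite ler_wpM2l // mulr_ge0 // addr_ge0 // divr_ge0.
have h2 : 2 <= C%:R * (2 / s%:R) :> R.
  rewrite mulrCA -[leLHS]mulr1 ler_pM2l // ler_pdivlMr ?mul1r ?ler_nat; last lra.
  exact: leq_trans CN.
have h3 : (2 ^ N)%:R * log2 b <= C%:R * (6 / s%:R).
  apply: le_trans (ler_wpM2l _ lb) _ => //.
  have u3 : 2 ^+ N / Num.sqrt N%:R <= 3 * C%:R :> R.
    by rewrite ler_pdivrMr ?sqrtr_gt0 // middle_bin_sqrt // -(ltr0n R).
  have -> : (2 ^ N)%:R * (2 * (s%:R * Num.sqrt N%:R)^-1) =
            2 * (2 ^+ N / Num.sqrt N%:R) / s%:R :> R.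
    by rewrite natrX invfM !mulrA [2 ^+ N * 2]mulrC mulrAC.
  rewrite [C%:R * (6 / _)]mulrA ler_pM2r ?invr_gt0; lra.
rewrite -addn2 natrD; lra.
Qed.
End CountingBound.

(** * Solving for the number of orientations *)

Section Asymptotics.
Variable R : realType.
Implicit Types s N n k : nat.

Let c : R := 2^-1 * (log2 pi + 1).

(* Asymptotically log2 'C(x - 1, (x - 1) / 2). *)
Definition log2_size (x : R) : R := x - c - 2^-1 * log2 x.

Definition main_term n : R :=
  log2 (log2 n%:R) + 2^-1 * log2 (log2 (log2 n%:R)) + c.

Lemma const_bounds : 1 <= c <= 3 / 2.
Proof.
have p2 := pi_ge2 R; have p4 : pi <= 2 ^+ 2 :> R by have := pihalf_lt2 R; lra.
have h1 : 1 <= log2 pi :> R by rewrite -[leLHS](@log2_2 R) le_log2.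
have h2 : log2 pi <= 2 :> R.
  by apply: le_trans (le_log2 (pi_gt0 R) p4) _; rewrite log2Xn // log2_2 mulr1.
by rewrite /c; apply/andP; split; lra.
Qed.

Lemma log2_middle_sqr N :
  log2 (('C(N, N./2)%:R / 2 ^+ N) ^+ 2) = 2 * log2 'C(N, N./2)%:R - 2 * N%:R :> R.
Proof.
have c0 : 0 < 'C(N, N./2)%:R :> R by rewrite ltr0n bin_gt0 -divn2 leq_div.
have t0 : 0 < 2 ^+ N :> R by rewrite exprn_gt0.
rewrite log2Xn ?divr_gt0 // log2M ?invr_gt0 // log2V // log2Xn // log2_2.
by rewrite mulr1 mulrBr.
Qed.

Lemma log2_two_div_pi N : (0 < N)%N -> log2 (2 / (pi * N%:R)) = 2 - 2 * c - log2 N%:R :> R.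
Proof.
move=> N0; have p0 := pi_gt0 R; have n0 : 0 < N%:R :> R by rewrite ltr0n.
rewrite log2M ?invr_gt0 ?mulr_gt0 // log2V ?mulr_gt0 // log2M // log2_2 /c; lra.
Qed.

Lemma log2_middle_le N : (0 < N)%N ->
  log2 'C(N, N./2)%:R <= log2_size N.+1%:R + N%:R^-1.
Proof.
move=> N0; have n0 : 0 < N%:R :> R by rewrite ltr0n.
have c0 : 0 < 'C(N, N./2)%:R :> R by rewrite ltr0n bin_gt0 -divn2 leq_div.
have t0 : 0 < 2 ^+ N :> R by rewrite exprn_gt0.
have := le_log2 _ (middle_bin_le R N0); rewrite log2_middle_sqr log2_two_div_pi //.
move=> /(_ (exprn_gt0 _ (divr_gt0 c0 t0))) h.
have : log2 N.+1%:R <= log2 N%:R + 2 * N%:R^-1 :> R.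
  have -> : N.+1%:R = N%:R * (1 + N%:R^-1) :> R.
    by rewrite mulrDr mulfV ?lt0r_neq0 // mulr1 natr1.
  have i0 : 0 <= N%:R^-1 :> R by rewrite invr_ge0.
  by rewrite log2M ?lerD2l ?log2_1D_le //; lra.
by have := natr1 N : _ = _ :> R; rewrite /log2_size; lra.
Qed.

Lemma log2_middle_ge N : (0 < N)%N ->
  log2_size N.+1%:R - N%:R^-1 <= log2 'C(N, N./2)%:R.
Proof.
move=> N0; have n0 : 0 < N%:R :> R by rewrite ltr0n.
have := le_log2 _ (middle_bin_ge R N); rewrite log2_middle_sqr log2_two_div_pi //.
rewrite divr_gt0 ?mulr_gt0 ?pi_gt0 ?ltr0n // => /(_ isT) h.
have : log2 N.+2%:R <= log2 N.+1%:R + 2 * N%:R^-1 :> R.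
  apply: (@le_trans _ _ (log2 (N.+1%:R * (1 + N%:R^-1)))).
    rewrite le_log2 ?ltr0n // mulrDr mulr1 -[N.+2%:R]natr1 lerD2l.
    by rewrite ler_pdivlMr // mul1r ler_nat.
  have i0 : 0 <= N%:R^-1 :> R by rewrite invr_ge0.
  by rewrite log2M ?ltr0n ?lerD2l ?log2_1D_le //; lra.
by have := natr1 N : _ = _ :> R; rewrite /log2_size; lra.
Qed.

(** [has_covering_of_le] needs [j.*2 < N], which for even [N] forces the layer just below the
    middle; the ratio 1 - 1/(N/2 + 1) costs at most 8/N. *)
Lemma log2_bin_below_middle_ge N : (1 < N)%N ->
  log2 'C(N, N./2)%:R - 8 / N%:R <= log2 'C(N, N.-1./2)%:R :> R.
Proof.
move=> N1; have n0 : 0 < N%:R :> R by rewrite ltr0n; lia.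
have c0 : 0 < 'C(N, N./2)%:R :> R by rewrite ltr0n bin_gt0 -divn2 leq_div.
have [oN|eN] := boolP (odd N).
  have -> : N.-1./2 = N./2 by lia.
  by rewrite lerBlDr lerDl divr_ge0.
have [m mE] : exists m, N./2 = m.+1 by exists N./2.-1; lia.
have Nm : N = m.+1.*2 by lia.
have -> : N.-1./2 = m by lia.
rewrite {}mE in c0 *.
have := mul_bin_left N m; rewrite {2}Nm.
have -> : (m.+1.*2 - m = m.+2)%N by lia.
move=> /(congr1 (fun i => i%:R : R)); rewrite !natrM => e.
have m2 : 0 < m.+2%:R :> R by rewrite ltr0n.
have c1 : 'C(N, m)%:R = 'C(N, m.+1)%:R * (1 - m.+2%:R^-1) :> R.
  apply: (mulfI (lt0r_neq0 m2)); rewrite -e -[m.+2%:R]natr1.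
  by field; apply: lt0r_neq0; have := ler0n R m; lra.
have h : 0 <= (m.+2%:R^-1 : R) <= 2^-1.
  by rewrite invr_ge0 ler0n lef_pV2 ?posrE // ler_nat.
have /andP[i0 i2] := h.
have := log2_1B_ge h; rewrite c1; set i := m.+2%:R^-1 in h i0 i2 *.
rewrite log2M //; last by lra.
have : i <= 2 / N%:R :> R.
  rewrite -[leLHS]mul1r ler_pdivrMr // mulrAC ler_pdivlMr // mul1r -natrM ler_nat.
  by lia.
lra.
Qed.

(** A second logarithm gives l <= [log2_size] (N + 1) + 25/s, where 24/s comes from log2 (1 + 12/s)
    and 1/s from 1/N. As 25/s <= 1 <= c, also l <= N + 1, so half of log2 l is absorbed by the last
    term of [log2_size]. *)
Lemma covering_main_le s N n : (25 <= s)%N -> (256 * s ^ 10 <= N)%N -> (1 < n)%N ->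
  has_orientation_covering (complete_graph n) N.+1 ->
  main_term n <= N.+1%:R + 25 / s%:R.
Proof.
move=> s25 sN n1 cov.
have s4 : (4 <= s)%N by lia.
have := covering_log2_le R s4 sN (ltnW n1) cov.
have s0 : 25 <= s%:R :> R by rewrite ler_nat.
have sleN : (s <= N)%N.
  apply: leq_trans sN; rewrite -[s in (s <= _)%N]mul1n leq_mul //.
  by rewrite -[s in (s <= _)%N]expn1 leq_pexp2l //; lia.
have N0 : (0 < N)%N by lia.
have c0 : 0 < 'C(N, N./2)%:R :> R by rewrite ltr0n bin_gt0 -divn2 leq_div.
have L0 : 0 < log2 n%:R :> R.
  by rewrite /log2 divr_gt0 ?ln2_gt0 // ln_gt0 // ltr1n.
have is0 : 0 <= 12 / s%:R :> R by rewrite divr_ge0.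
have p1 : 0 < 1 + 12 / s%:R :> R by rewrite ltr_wpDr.
move=> /(le_log2 L0); rewrite (log2M c0 p1).
have := log2_1D_le is0; have := log2_middle_le N0.
have : N%:R^-1 <= s%:R^-1 :> R by rewrite lef_pV2 ?posrE ?ltr0n ?ler_nat //; lia.
have s1 : s%:R^-1 <= 25^-1 :> R by rewrite lef_pV2 ?posrE //; lra.
rewrite /main_term; set l := log2 (log2 _) => h1 h2 h3 h4.
have k0 : 1 <= N.+1%:R :> R by rewrite ler1n.
have lk := log2_ge0 k0; have /andP[c1 _] := const_bounds.
have {h1 h2 h3 h4} lH : l <= log2_size N.+1%:R + 25 / s%:R by lra.
have l_le : l <= N.+1%:R by move: lH; rewrite /log2_size; lra.
have : log2 l <= log2 N.+1%:R.
  (* For [l <= 0] the convention that [log2] vanishes there is harmless, the right side being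
     nonnegative. *)
  have [l0|l0] := leP l 0; first by rewrite (log2_npos l0).
  exact: le_log2.
move: lH; rewrite /log2_size; lra.
Qed.

(** Now n exceeds 2^C(N, j), so l is at least [log2_size] k - 9/r, and crudely at least k (1 -
    13/q). The latter gives log2 l >= log2 k - 52/q; half of this loss plus 9 makes 35. The bound
    676 = 26^2 ensures 13/q <= 1/2 for [log2_1B_ge]. *)
Lemma not_covering_main_ge N n : (676 <= N)%N ->
  ~~ has_orientation_covering (complete_graph n) N.+1 ->
  N.+1%:R <= main_term n + 35 / Num.sqrt N%:R.
Proof.
move=> N676 ncov; have N0 : (0 < N)%N by lia.
set j := N.-1./2.
have nj : (2 ^ 'C(N, j) < n)%N.
  by rewrite ltnNge; apply: contra ncov => h; apply: (has_covering_of_le _ h); lia.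
have jN : (j <= N)%N by lia.
have L_ge : 'C(N, j)%:R <= log2 n%:R :> R.
  have -> : 'C(N, j)%:R = log2 (2 ^+ 'C(N, j)) :> R by rewrite log2Xn // log2_2 mulr1.
  by rewrite le_log2 ?exprn_gt0 // -natrX ler_nat ltnW.
have cj : 0 < 'C(N, j)%:R :> R by rewrite ltr0n bin_gt0.
have l_ge := le_log2 cj L_ge.
rewrite /main_term; set l := log2 (log2 _) in l_ge *.
set k : R := N.+1%:R; pose q := Num.sqrt k; pose r : R := Num.sqrt N%:R.
have n0 : 676 <= N%:R :> R by rewrite ler_nat.
have r2 : r ^+ 2 = N%:R by rewrite sqr_sqrtr.
have q2 : q ^+ 2 = k by rewrite sqr_sqrtr.
have r26 : 26 <= r.
  rewrite -[leLHS]ger0_norm // -sqrtr_sqr ler_wsqrtr //; lra.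
have rq : r <= q by rewrite ler_wsqrtr // ler_nat.
have N1 : (1 < N)%N by lia.
have := log2_middle_ge N0; have := log2_bin_below_middle_ge N1; rewrite -/j => h1 h2.
have Nr : N%:R^-1 <= r^-1 by rewrite lef_pV2 ?posrE; nra.
have qr : q^-1 <= r^-1 by rewrite lef_pV2 ?posrE; lra.
have {h1 h2} lH : log2_size k - 9 * r^-1 <= l by rewrite -/k in h2; lra.
have k0 : 0 < k by rewrite ltr0n.
have lk := log2_le_sqrt k0; have /andP[c1 c2] := const_bounds; rewrite -/q in lk.
have r1 : r^-1 <= 26^-1 by rewrite lef_pV2 ?posrE //; lra.
have kq : k / q = q by rewrite -q2 expr2 mulfK // lt0r_neq0 //; lra.
have hq : 0 <= 13 / q <= 2^-1.
  apply/andP; split; first by rewrite divr_ge0 //; lra.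
  have : q^-1 <= 26^-1 by lra.
  lra.
have kl : k * (1 - 13 / q) <= l.
  have -> : k * (1 - 13 / q) = k - 13 * q by rewrite mulrBr mulr1 mulrCA kq.
  move: lH; rewrite /log2_size; lra.
have y0 : 0 < 1 - 13 / q by lra.
have := le_log2 (mulr_gt0 k0 y0) kl; rewrite log2M //.
have := log2_1B_ge hq.
by move: lH; rewrite /log2_size; lra.
Qed.

(** The trivial bound 2^(2^N) on the number of antichains suffices to make [N] as large as the
    estimates demand. *)
Lemma covering_number_ge k0 : exists n0, forall n, (n0 <= n)%N ->
  (k0 < orientation_covering_number (complete_graph n))%N.
Proof.
exists (2 ^ 2 ^ k0).+1 => n n0; rewrite ltnNge; apply/negP.
rewrite /orientation_covering_number; case: ex_minnP => -[//|N] /= cov _ Nk.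
case/existsP: cov => D /covering_antichains cov.
have := leq_trans n0 (leq_trans cov (max_card _)); apply/negP; rewrite -leqNgt.
by rewrite !card_set_type card_ord !leq_pexp2l // ltnW.
Qed.

Lemma covering_number_main (e : R) : 0 < e ->
  \forall n \near \oo,
    main_term n - e <= (orientation_covering_number (complete_graph n))%:R /\
    (orientation_covering_number (complete_graph n))%:R - 1 <= main_term n + e.
Proof.
(* The summand [s] gives 35/t <= e, and the summand 35 gives both 25 <= t and 676 <= t^2. *)
move=> e0; pose s := (Num.truncn (35 / e)).+1; pose t := (s + 35)%N.
have st : 35 / t%:R <= e.
  have : 35 / e < s%:R by rewrite truncnS_gt.
  rewrite ltr_pdivrMr // => h; rewrite ler_pdivrMr ?ltr0n /t ?addn_gt0 //.
  by rewrite natrD; lra.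
have t0 : 0 < t%:R :> R by rewrite ltr0n /t addn_gt0 orbT.
have [n0 Hn0] := covering_number_ge (256 * t ^ 10).+2.
near=> n.
have sig : ((256 * t ^ 10).+2 < orientation_covering_number (complete_graph n))%N.
  by apply: Hn0; near: n; exact: nbhs_infty_ge.
have n1 : (1 < n)%N by near: n; exact: nbhs_infty_gt.
move: sig; rewrite /orientation_covering_number.
case: ex_minnP => -[//|[//|N]] /= cov minN sig.
have tN : (256 * t ^ 10 <= N)%N by lia.
have t2N : (t ^ 2 <= N)%N.
  apply: leq_trans tN; rewrite -[(t ^ 2)%N]mul1n leq_mul // leq_pexp2l //; lia.
split.
  have t25 : (25 <= t)%N by rewrite /t; lia.
  have := covering_main_le t25 (leqW tN) n1 cov.
  have : 25 / t%:R <= 35 / t%:R :> R by rewrite ler_pM2r ?invr_gt0 //; lra.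
  lra.
(* The covering number is [N.+2], so minimality rules out [N.+1] orientations. *)
have ncov : ~~ has_orientation_covering (complete_graph n) N.+1.
  by apply/negP => h; have := minN N.+1 h; rewrite ltnn.
have N676 : (676 <= N)%N by rewrite /t in t2N; nia.
have := not_covering_main_ge N676 ncov.
have : 35 / Num.sqrt N%:R <= 35 / t%:R :> R.
  have tq : t%:R <= Num.sqrt N%:R :> R.
    by rewrite -[leLHS]ger0_norm // -sqrtr_sqr ler_wsqrtr // -natrX ler_nat.
  by rewrite ler_pM2l // lef_pV2 ?posrE //; lra.
rewrite -[N.+2%:R]natr1; lra.
Unshelve. all: by end_near.
Qed.
End Asymptotics.

Theorem theorem2 (R : realType) :
  exists eps : nat -> R,
    eps n @[n --> \oo] --> (0 : R) /\
    \forall n \near \oo,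
      (orientation_covering_number (complete_graph n))%:Z =
      Num.ceil (log2 (log2 (n%:R : R))
                + 2^-1 * log2 (log2 (log2 (n%:R : R)))
                + 2^-1 * (log2 (pi : R) + 1)
                + eps n).
Proof.
pose sg n : R := (orientation_covering_number (complete_graph n))%:R.
(* A positive null sequence that keeps the adjusted value strictly above [sg n - 1], the open end of
   the interval. *)
pose h n : R := n.+1%:R^-1.
have h0 n : 0 < h n by rewrite invr_gt0 ltr0n.
have h1 n : h n <= 1 by rewrite invf_le1 ?ltr0n // ler1n.
(* This choice puts [main_term n + eps n] in ]sg n - 1, sg n]. *)
exists (fun n => Num.min (Num.max (main_term R n) (sg n - 1 + h n)) (sg n) - main_term R n).
split; last first.
  near=> n; apply/esym/ceil_def; rewrite -/(main_term R n) [_ + (_ - _)]addrC subrK.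
  rewrite rmorphB /= -pmulrn -/(sg n) lt_min ge_min lexx orbT andbT lt_max.
  by apply/andP; split; [apply/orP; right|]; have := h0 n; lra.
apply/cvgrPdist_le => e e0.
have e2 : 0 < e / 2 by rewrite divr_gt0.
have hh : \forall n \near \oo, h n <= e / 2.
  have /cvgrPdist_le/(_ _ e2) := @cvg_harmonic R.
  by apply: filterS => n; rewrite /harmonic /= sub0r normrN ger0_norm.
near=> n.
have [lo hi] : main_term R n - e / 2 <= sg n /\ sg n - 1 <= main_term R n + e / 2.
  by near: n; exact: covering_number_main.
have hn : h n <= e / 2 by near: n.
(* The value [main_term R n] is lowered at most to [sg n] and raised at most to [sg n - 1 + h n],
   hence moved by at most e/2 and e. *)
rewrite sub0r normrN ler_norml; apply/andP; split.
  by rewrite lerBrDr le_min le_max; apply/andP; split; [apply/orP; left|]; lra.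
by rewrite lerBlDr ge_min; apply/orP; left; rewrite ge_max; apply/andP; split; lra.
Unshelve. all: by end_near.
Qed.
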